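(* On the double tetrahedron, at an equal length metric, both $\mathcal{LEHR}$ and $\mathcal{VEHR}$ are convex within a conformal class. That is, if $k>0$ and $L_{ij}=k$ for all six edges, and $\ell_{ij}(f)=\exp\left[\tfrac12(f_i+f_j)\right]L_{ij}$ for $f=(f_1,f_2,f_3,f_4)$ near $0\in\mathbb{R}^4$, then for $\mathcal{F}=\mathcal{LEHR}$ and for $\mathcal{F}=\mathcal{VEHR}$ the $4\times4$ Hessian of $f\mapsto\mathcal{F}(\ell(f))$ at $f=0$ is positive semidefinite.
   Context: The double tetrahedron $\mathrm{DT}$ is the triangulation of $S^3$ obtained by gluing two congruent Euclidean tetrahedra along corresponding boundary faces. It has vertices $1,2,3,4$ and six edges $ij$. A metric is a vector $\ell=(\ell_{ij})$ of positive numbers that are the edge lengths of a nondegenerate Euclidean tetrahedron (the generating tetrahedron). Let $\beta_{ij}\in(0,\pi)$ be the dihedral angle of the generating tetrahedron at edge $ij$, and define $K_{ij}=(2\pi-2\beta_{ij})\ell_{ij}$, $\mathcal{EHR}=\sum_{ij}K_{ij}$, $\mathcal{L}=\sum_{ij}\ell_{ij}$, $\mathcal{V}=$ twice the volume of the generating tetrahedron, $\mathcal{LEHR}=\mathcal{EHR}/\mathcal{L}$, $\mathcal{VEHR}=\mathcal{EHR}/\mathcal{V}^{1/3}$. The conformal class of a metric $L$ is the set of metrics of the form $\ell_{ij}(f)=\exp[\tfrac12(f_i+f_j)]L_{ij}$, with $f$ a real function on the vertices. An equal length metric is a metric with all six edge lengths equal. *)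

(* Defs.v *)
From mathcomp Require Import all_boot all_order all_algebra.
From mathcomp Require Import all_classical all_reals all_analysis.

Set Implicit Arguments.
Unset Strict Implicit.
Unset Printing Implicit Defensive.

Import Order.TTheory GRing.Theory Num.Theory.
Import numFieldNormedType.Exports.

Local Open Scope classical_set_scope.
Local Open Scope ring_scope.

Section EuclideanSpace.
Context {R : realType}.
Implicit Types u v e : 'rV[R]_3.

Definition dot u v : R := (u *m v^T) 0 0.

(* The norm [`|u|] provided by the library on row vectors is the sup norm. *)
Definition enorm u : R := Num.sqrt (dot u u).

Definition angle u v : R := acos (dot u v / (enorm u * enorm v)).

Definition orthogonal_part e u : 'rV[R]_3 := u - (dot u e / dot e e) *: e.

End EuclideanSpace.

(* The vertices 1, 2, 3, 4 are the elements of ['I_4]. A tetrahedron is given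
   by the matrix whose four rows are its vertices in Euclidean 3-space. *)
Section Tetrahedron.
Context {R : realType}.
Implicit Types (P : 'M[R]_(4, 3)) (i j : 'I_4).

Definition edge_matrix P : 'M[R]_3 :=
  \matrix_(i < 3) (row (lift ord0 i) P - row ord0 P).

Definition nondegenerate P : Prop := \det (edge_matrix P) != 0.

Definition volume P : R := `|\det (edge_matrix P)| / 6.

Definition other_vertices i j : seq 'I_4 :=
  [seq k <- enum 'I_4 | (k != i) && (k != j)].

(* The faces meeting along the edge ij are ijk and ijl, where k and l are the
   other two vertices. The dihedral angle is the angle between the directions
   orthogonal to the edge and pointing into these two faces. *)
Definition dihedral_angle P i j : R :=
  let k := nth i (other_vertices i j) 0%N in
  let l := nth i (other_vertices i j) 1%N in
  let e := row j P - row i P in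
  angle (orthogonal_part e (row k P - row i P))
        (orthogonal_part e (row l P - row i P)).

End Tetrahedron.

(* A length vector assigns a real number to each of the six edges; it is a
   function of two vertices, of which only the values at i < j are relevant. *)
Section DoubleTetrahedron.
Context {R : realType}.
Implicit Types (l : 'I_4 -> 'I_4 -> R) (P : 'M[R]_(4, 3)).

Definition generates P l : Prop :=
  nondegenerate P /\
  forall i j : 'I_4, (i < j)%N -> enorm (row j P - row i P) = l i j.

(* A metric is a length vector generated by some tetrahedron, which is then
   unique up to isometry; one such tetrahedron is chosen, and the value is
   irrelevant when [l] is not a metric. The angles and the volume used below
   are invariant under isometry. *)
Definition tetrahedron l : 'M[R]_(4, 3) := xget 0 [set P | generates P l].

Definition curvature l (i j : 'I_4) : R :=
  (2 * pi - 2 * dihedral_angle (tetrahedron l) i j) * l i j.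

Definition EHR l : R :=
  \sum_(i < 4) \sum_(j < 4 | (i < j)%N) curvature l i j.

Definition total_length l : R :=
  \sum_(i < 4) \sum_(j < 4 | (i < j)%N) l i j.

Definition total_volume l : R := 2 * volume (tetrahedron l).

Definition LEHR l : R := EHR l / total_length l.

Definition VEHR l : R := EHR l / (total_volume l `^ 3^-1).

Definition conformal (L : 'I_4 -> 'I_4 -> R) (f : 'rV[R]_4) :
    'I_4 -> 'I_4 -> R :=
  fun i j => expR ((f 0 i + f 0 j) / 2) * L i j.

End DoubleTetrahedron.

Section Hessian.
Context {R : realType} {n : nat}.
Implicit Types (F : 'rV[R]_n.+1 -> R) (a : 'rV[R]_n.+1).

Definition partial F (i : 'I_n.+1) (x : 'rV[R]_n.+1) : R :=
  'D_(delta_mx 0 i) F x.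

Definition hessian F a : 'M[R]_n.+1 :=
  \matrix_(i, j) partial (partial F j) i a.

(* [partial] is total, so the existence of the derivatives entering the
   Hessian is a separate property. *)
Definition has_hessian F a : Prop :=
  (\forall x \near a, forall i, derivable F x (delta_mx 0 i)) /\
  (forall i j, derivable (partial F j) a (delta_mx 0 i)).

End Hessian.

Definition positive_semidefinite {R : realType} {n : nat} (A : 'M[R]_n) :
    Prop :=
  A^T = A /\ forall v : 'rV[R]_n, 0 <= (v *m A *m v^T) 0 0.

(* Main.v *)
Require Import Defs.
From mathcomp Require Import all_boot all_order all_algebra.
From mathcomp Require Import all_classical all_reals all_analysis.
From mathcomp Require Import ring lra.

(* With [a_i = exp (- f_i)], the squared lengths in the conformal class are
   [k^2 / (a_i a_j)], and face areas, volume and dihedral angles become simple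
   expressions in the [a_i]. Schlafli's formula [sum l_ij d(beta_ij) = 0] gives
   [d EHR = sum (2 pi - 2 beta_ij) d l_ij], so that second derivatives of EHR
   only involve first derivatives of the dihedral angles; at [f = 0] the
   derivative of [beta_ij] along [w] is a negative multiple of
   [w_i + w_j - w_k - w_l]. The equal length metric is critical for LEHR and
   VEHR in its conformal class. There the Hessian of LEHR is a positive multiple
   of the sum over the three pairs of opposite edges of
   [(v_i + v_j - v_k - v_l)^2], and that of VEHR is a positive combination of
   this form with [sum_(i < j) (v_i - v_j)^2]. *)

Set Implicit Arguments.
Unset Strict Implicit.
Unset Printing Implicit Defensive.

Import Order.TTheory GRing.Theory Num.Theory.
Import numFieldNormedType.Exports.

Local Open Scope ring_scope.

(** * Directional derivatives *)

Section DirectionalDerivative.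
Context {R : realType} {V : normedModType R}.
Implicit Types (f : V -> R) (x v : V) (df : R).

(** A directional derivative only sees the restriction to a line, so the one-variable chain rule and
    inverse rule become available on [V]. *)
Lemma is_derive_lineP f x v df :
  is_derive x v f df <-> is_derive (0 : R) 1 (fun h : R => f (h *: v + x)) df.
Proof.
have lineE : 'D_v f x = 'D_1 (fun h : R => f (h *: v + x)) 0.
  rewrite /derive; set g1 := fun h => h^-1 *: _; set g2 := fun h => h^-1 *: _.
  suff -> : g1 = g2 by [].
  by apply/funext => h; rewrite /g1 /g2 /= addr0 scale0r add0r [h%:A]mulr1.
split=> -[fx <-]; split; first exact: (derivable1P _ _ _).1.
- by rewrite lineE.
- exact: (derivable1P _ _ _).2.
- by rewrite lineE.
Qed.

Lemma is_derive_comp (g : R -> R) f x v df (dg : R) :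
  is_derive x v f df -> is_derive (f x) 1 g dg ->
  is_derive x v (fun y => g (f y)) (dg * df).
Proof.
move=> /is_derive_lineP fx gfx; apply/is_derive_lineP.
by apply: is_derive1_comp; rewrite scale0r add0r.
Qed.

(** The numerator [df - f x * dg / g x] is kept apart from the outer division: it vanishes exactly
    at critical points of the quotient, and the same rule differentiates the expression a second
    time. *)
Lemma is_derive_div f (g : V -> R) x v df (dg : R) : g x != 0 ->
  is_derive x v f df -> is_derive x v g dg ->
  is_derive x v (fun y => f y / g y) ((df - f x * dg / g x) / g x).
Proof.
move=> gx0 fx gx.
have gV : is_derive x v (fun y => (g y)^-1) (- (g x)^-2 * dg).
  apply/is_derive_lineP; move/is_derive_lineP : gx => gx.
  have := @is_deriveV _ (fun h : R => g (h *: v + x)) 0 dg 1.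
  by rewrite scale0r add0r /GRing.scale /= => /(_ gx0 gx).
have := is_deriveM fx gV.
rewrite /GRing.scale /= => fgV; refine (is_derive_eq fgV _).
field.
exact: gx0.
Qed.

End DirectionalDerivative.

(** * Polynomials of a conformal tetrahedron *)

Section Polynomials.
Context {R : realType}.
Implicit Types a b c d da db dc dd : R.

(* The lengths are [l_ij^2 = k^2 / (a_i a_j)] with [a_i = exp (- f_i)]. Up to
   constants and powers of the [a_i], [face_poly] is the squared area of a face,
   [volume_poly] the squared volume, and [dihedral_poly a b c d] the inner
   product, for the edge [ab], of the components of [ac] and [ad] orthogonal
   to [ab]. *)
Definition face_poly a b c : R :=
  2 * (a * b + a * c + b * c) - (a ^+ 2 + b ^+ 2 + c ^+ 2).

Definition volume_poly a b c d : R :=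
  2 * (a * b + a * c + a * d + b * c + b * d + c * d) -
  2 * (a ^+ 2 + b ^+ 2 + c ^+ 2 + d ^+ 2).

Definition dihedral_poly a b c d : R :=
  (a + b) * (c + d) - c * d - a ^+ 2 - b ^+ 2.

Definition dface_poly a b c da db dc : R :=
  2 * (da * (b + c - a) + db * (a + c - b) + dc * (a + b - c)).

Definition dvolume_poly a b c d da db dc dd : R :=
  2 * (da * (b + c + d - 2 * a) + db * (a + c + d - 2 * b) +
       dc * (a + b + d - 2 * c) + dd * (a + b + c - 2 * d)).

Definition ddihedral_poly a b c d da db dc dd : R :=
  da * (c + d - 2 * a) + db * (c + d - 2 * b) +
  dc * (a + b - d) + dd * (a + b - c).

Definition dihedral a b c d : R :=
  acos (dihedral_poly a b c d /
        Num.sqrt (face_poly a b c * face_poly a b d)).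

(* [- ddihedral_num / sqrt (2 a b volume_poly)] is the differential of
   [dihedral]. *)
Definition ddihedral_num a b c d da db dc dd : R :=
  ddihedral_poly a b c d da db dc dd -
  dihedral_poly a b c d / 2 *
  (dface_poly a b c da db dc / face_poly a b c +
   dface_poly a b d da db dd / face_poly a b d).

(** This is cos^2 + sin^2 = 1 for the dihedral angle, with the sine given by the volume formula V =
    2 A A' sin(beta) / (3 l), where A and A' are the areas of the faces meeting at the edge of
    length l. *)
Lemma dihedral_poly_sqr a b c d :
  face_poly a b c * face_poly a b d =
  dihedral_poly a b c d ^+ 2 + 2 * (a * b) * volume_poly a b c d.
Proof. rewrite /face_poly /dihedral_poly /volume_poly; ring. Qed.

(* In Schlafli's formula this cancels the denominator coming from the face. *)
Lemma sum_dihedral_poly_face a b c d :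
  a != 0 -> b != 0 -> c != 0 ->
  dihedral_poly a b c d / (a * b) + dihedral_poly a c b d / (a * c) +
  dihedral_poly b c a d / (b * c) = d * face_poly a b c / (a * b * c).
Proof.
move=> a0 b0 c0; rewrite /dihedral_poly /face_poly; field.
by rewrite a0 b0 c0.
Qed.

(* Schlafli's formula [sum l_ij d(beta_ij) = 0], cleared of the common factor
   [k / sqrt (2 volume_poly)]. *)
Lemma schlafli a b c d da db dc dd :
  a != 0 -> b != 0 -> c != 0 -> d != 0 ->
  face_poly a b c != 0 -> face_poly a b d != 0 ->
  face_poly a c d != 0 -> face_poly b c d != 0 ->
  ddihedral_num a b c d da db dc dd / (a * b) +
  ddihedral_num a c b d da dc db dd / (a * c) +
  ddihedral_num a d b c da dd db dc / (a * d) +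
  ddihedral_num b c a d db dc da dd / (b * c) +
  ddihedral_num b d a c db dd da dc / (b * d) +
  ddihedral_num c d a b dc dd da db / (c * d) = 0.
Proof.
move=> a0 b0 c0 d0 Qabc Qabd Qacd Qbcd.
have Qabc_sum := sum_dihedral_poly_face d a0 b0 c0.
have Qabd_sum := sum_dihedral_poly_face c a0 b0 d0.
have Qacd_sum := sum_dihedral_poly_face b a0 c0 d0.
have Qbcd_sum := sum_dihedral_poly_face a b0 c0 d0.
(* These symmetries bring every face to increasing vertex order, so that only four face polynomials
   and four of their differentials remain. *)
have dPs x y z w : dihedral_poly x y z w = dihedral_poly x y w z.
  rewrite /dihedral_poly; ring.
have Qs x y z : face_poly x z y = face_poly x y z by rewrite /face_poly; ring.
have Qr x y z : face_poly y z x = face_poly x y z by rewrite /face_poly; ring.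
have dQs x y z dx dy dz : dface_poly x z y dx dz dy = dface_poly x y z dx dy dz.
  rewrite /dface_poly; ring.
have dQr x y z dx dy dz : dface_poly y z x dy dz dx = dface_poly x y z dx dy dz.
  rewrite /dface_poly; ring.
rewrite /ddihedral_num.
rewrite [face_poly a c b]Qs [face_poly a d b]Qs [face_poly a d c]Qs.
rewrite [face_poly b c a]Qr [face_poly b d a]Qr [face_poly b d c]Qs.
rewrite [face_poly c d a]Qr [face_poly c d b]Qr.
rewrite [dface_poly a c b _ _ _]dQs [dface_poly a d b _ _ _]dQs.
rewrite [dface_poly a d c _ _ _]dQs [dface_poly b c a _ _ _]dQr.
rewrite [dface_poly b d a _ _ _]dQr [dface_poly b d c _ _ _]dQs.
rewrite [dface_poly c d a _ _ _]dQr [dface_poly c d b _ _ _]dQr.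
(* The logarithmic derivatives of the four faces are made opaque, which keeps the face polynomials
   out of the denominators. *)
set rabc := dface_poly a b c da db dc / _.
set rabd := dface_poly a b d da db dd / _.
set racd := dface_poly a c d da dc dd / _.
set rbcd := dface_poly b c d db dc dd / _.
have rabcE : rabc * face_poly a b c = dface_poly a b c da db dc.
  by rewrite divfK.
have rabdE : rabd * face_poly a b d = dface_poly a b d da db dd.
  by rewrite divfK.
have racdE : racd * face_poly a c d = dface_poly a c d da dc dd.
  by rewrite divfK.
have rbcdE : rbcd * face_poly b c d = dface_poly b c d db dc dd.
  by rewrite divfK.
(* Regrouped by face, each logarithmic derivative multiplies the sum of [dihedral_poly] terms over
   the three edges of its face. By [sum_dihedral_poly_face] this sum is a multiple of the face
   polynomial, which cancels the denominator. *)
transitivity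
  (ddihedral_poly a b c d da db dc dd / (a * b) +
   ddihedral_poly a c b d da dc db dd / (a * c) +
   ddihedral_poly a d b c da dd db dc / (a * d) +
   ddihedral_poly b c a d db dc da dd / (b * c) +
   ddihedral_poly b d a c db dd da dc / (b * d) +
   ddihedral_poly c d a b dc dd da db / (c * d) -
   2^-1 * (d * (rabc * face_poly a b c) / (a * b * c) +
           c * (rabd * face_poly a b d) / (a * b * d) +
           b * (racd * face_poly a c d) / (a * c * d) +
           a * (rbcd * face_poly b c d) / (b * c * d))).
  transitivity
  (ddihedral_poly a b c d da db dc dd / (a * b) +
   ddihedral_poly a c b d da dc db dd / (a * c) +
   ddihedral_poly a d b c da dd db dc / (a * d) +
   ddihedral_poly b c a d db dc da dd / (b * c) +
   ddihedral_poly b d a c db dd da dc / (b * d) +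
   ddihedral_poly c d a b dc dd da db / (c * d) -
   2^-1 * (rabc * (d * face_poly a b c / (a * b * c)) +
           rabd * (c * face_poly a b d / (a * b * d)) +
           racd * (b * face_poly a c d / (a * c * d)) +
           rbcd * (a * face_poly b c d / (b * c * d)))); last by ring.
  rewrite -Qabc_sum -Qabd_sum -Qacd_sum -Qbcd_sum.
  rewrite [dihedral_poly a b d c]dPs [dihedral_poly a c d b]dPs.
  rewrite [dihedral_poly a d c b]dPs [dihedral_poly b c d a]dPs.
  rewrite [dihedral_poly b d c a]dPs [dihedral_poly c d b a]dPs.
  ring.
rewrite rabcE rabdE racdE rbcdE /ddihedral_poly /dface_poly.
field.
by rewrite a0 b0 c0 d0.
Qed.

End Polynomials.

(** * Differentials of the face, volume and dihedral polynomials *)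

Section PolynomialDerivatives.
Context {R : realType} {V : normedModType R}.
Variables (A B C D : V -> R) (x v : V) (dA dB dC dD : R).
Hypotheses (Ax : is_derive x v A dA) (Bx : is_derive x v B dB)
  (Cx : is_derive x v C dC) (Dx : is_derive x v D dD).

Lemma is_derive_face_poly :
  is_derive x v (fun y => face_poly (A y) (B y) (C y))
    (dface_poly (A x) (B x) (C x) dA dB dC).
Proof.
rewrite /face_poly /dface_poly; apply: is_derive_eq.
rewrite /GRing.scale /=; ring.
Qed.

Lemma is_derive_volume_poly :
  is_derive x v (fun y => volume_poly (A y) (B y) (C y) (D y))
    (dvolume_poly (A x) (B x) (C x) (D x) dA dB dC dD).
Proof.
rewrite /volume_poly /dvolume_poly; apply: is_derive_eq.
rewrite /GRing.scale /=; ring.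
Qed.

Lemma is_derive_dihedral_poly :
  is_derive x v (fun y => dihedral_poly (A y) (B y) (C y) (D y))
    (ddihedral_poly (A x) (B x) (C x) (D x) dA dB dC dD).
Proof.
rewrite /dihedral_poly /ddihedral_poly; apply: is_derive_eq.
rewrite /GRing.scale /=; ring.
Qed.

End PolynomialDerivatives.

(** * Differential of the dihedral angle *)

Section DihedralDerivative.
Context {R : realType} {V : normedModType R}.
Variables (A B C D : V -> R) (x v : V) (dA dB dC dD : R).
Hypotheses (Ax : is_derive x v A dA) (Bx : is_derive x v B dB)
  (Cx : is_derive x v C dC) (Dx : is_derive x v D dD).

Lemma is_derive_dihedral :
  0 < A x -> 0 < B x -> 0 < face_poly (A x) (B x) (C x) ->
  0 < face_poly (A x) (B x) (D x) ->
  0 < volume_poly (A x) (B x) (C x) (D x) ->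
  is_derive x v (fun y => dihedral (A y) (B y) (C y) (D y))
    (- (ddihedral_num (A x) (B x) (C x) (D x) dA dB dC dD /
        Num.sqrt (2 * (A x * B x) * volume_poly (A x) (B x) (C x) (D x)))).
Proof.
move=> A0 B0 Q0 Q'0 W0.
pose Q y := face_poly (A y) (B y) (C y).
pose Q' y := face_poly (A y) (B y) (D y).
pose N y := dihedral_poly (A y) (B y) (C y) (D y).
have Qx := is_derive_face_poly Ax Bx Cx.
have Q'x := is_derive_face_poly Ax Bx Dx.
have Nx := is_derive_dihedral_poly Ax Bx Cx Dx.
set dQ := dface_poly _ _ _ _ _ _ in Qx.
set dQ' := dface_poly _ _ _ _ _ _ in Q'x.
set dN := ddihedral_poly _ _ _ _ _ _ _ _ in Nx.
have QQ0 : 0 < Q x * Q' x by rewrite mulr_gt0.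
have sQQ0 : 0 < Num.sqrt (Q x * Q' x) by rewrite sqrtr_gt0.
have sW0 : 0 < 2 * (A x * B x) * volume_poly (A x) (B x) (C x) (D x).
  by rewrite !mulr_gt0.
(* The squared sine of the angle. Its positivity also puts the cosine strictly between -1 and 1,
   where [acos] is differentiable. *)
have sqrt1B : 1 - (N x / Num.sqrt (Q x * Q' x)) ^+ 2 =
    2 * (A x * B x) * volume_poly (A x) (B x) (C x) (D x) / (Q x * Q' x).
  rewrite expr_div_n sqr_sqrtr ?ltW //.
  have -> : 2 * (A x * B x) * volume_poly (A x) (B x) (C x) (D x) =
     Q x * Q' x - N x ^+ 2 by rewrite /Q /Q' /N dihedral_poly_sqr; ring.
  by rewrite [RHS]mulrBl divff // gt_eqF.
have N1 : -1 < N x / Num.sqrt (Q x * Q' x) < 1.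
  rewrite -ltr_norml -(@ltr_pXn2r _ 2) ?nnegrE // real_normK ?num_real //.
  by rewrite expr1n -subr_gt0 sqrt1B divr_gt0.
have QQx : is_derive x v (fun y => Q y * Q' y) (Q x * dQ' + Q' x * dQ).
  by apply: is_derive_eq.
have sqrtx := is_derive_comp QQx (is_derive1_sqrt QQ0).
have divx := @is_derive_div _ _ N (fun y => Num.sqrt (Q y * Q' y)) x v _ _
  (lt0r_neq0 sQQ0) Nx sqrtx.
have acosx := is_derive_comp divx (is_derive1_acos N1).
refine (is_derive_eq acosx _).
rewrite sqrt1B sqrtrM ?(ltW sW0) // sqrtrV ?ltW //.
rewrite /ddihedral_num -/dN -/dQ -/dQ' -/(N x) -/(Q x) -/(Q' x).
set s := Num.sqrt (Q x * Q' x) in sQQ0 *.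
have s2 : Q x * Q' x = s ^+ 2 by rewrite /s sqr_sqrtr ?ltW.
set w := Num.sqrt _.
have w0 : 0 < w by rewrite sqrtr_gt0.
(* Eliminating [Q' x] removes the relation between [s], [Q x] and [Q' x], leaving a purely rational
   identity. *)
have -> : Q' x = s ^+ 2 / Q x by rewrite -s2 mulrAC divff ?mul1r // gt_eqF.
field.
by rewrite !gt_eqF.
Qed.

End DihedralDerivative.

(** * Hessians *)

Section Hessian.
Context {R : realType} {n : nat}.
Implicit Types (F G : 'rV[R]_n.+1 -> R) (a v w : 'rV[R]_n.+1).

Lemma is_derive_coord a v i :
  is_derive a v (fun x : 'rV[R]_n.+1 => x 0 i) (v 0 i).
Proof.
apply/is_derive_lineP.
rewrite (_ : (fun h : R => _) = fun h => h * v 0 i + a 0 i); last first.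
  by apply/funext => h; rewrite !mxE.
by apply: is_derive_eq; rewrite /GRing.scale /= mulr0 mulr1 add0r addr0.
Qed.

Lemma partial_is_derive F a (dF : R) i :
  is_derive a (delta_mx 0 i) F dF -> partial F i a = dF.
Proof. by move=> Fa; rewrite /partial derive_val. Qed.

(** Near [a] the partial derivatives of [F] agree with the explicit [dF], so differentiating [dF] at
    [a] alone yields the Hessian. The expansion of [H v v] over basis vectors stands in for
    bilinearity; for an explicit [H] it is a computation. *)
Lemma hessian_psd F a (dF H : 'rV[R]_n.+1 -> 'rV[R]_n.+1 -> R) :
  (\near a, forall v, is_derive a v F (dF v a)) ->
  (forall v w, is_derive a w (dF v) (H v w)) ->
  (forall v w, H v w = H w v) ->
  (forall v, H v v =
     \sum_i \sum_j v 0 i * v 0 j * H (delta_mx 0 j) (delta_mx 0 i)) ->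
  (forall v, 0 <= H v v) ->
  has_hessian F a /\ positive_semidefinite (hessian F a).
Proof.
move=> Fa dFa Hsym Hsum H0.
have partialE j : \near a, dF (delta_mx 0 j) a = partial F j a.
  near=> x; apply/esym/partial_is_derive.
  by near: x; apply: filterS Fa => x; exact.
have partial2 i j : is_derive a (delta_mx 0 i) (partial F j)
    (H (delta_mx 0 j) (delta_mx 0 i)).
  exact: near_eq_is_derive (partialE j) (dFa _ _).
have hessE i j : hessian F a i j = H (delta_mx 0 j) (delta_mx 0 i).
  by rewrite mxE; apply: partial_is_derive.
split; first split.
- by apply: filterS Fa => x Fx i; have [] := Fx (delta_mx 0 i).
- by move=> i j; have [] := partial2 i j.
split; first by apply/matrixP => i j; rewrite [LHS]mxE !hessE.
move=> v; rewrite (_ : _ 0 0 = H v v)//.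
rewrite Hsum -mulmxA mxE; apply: eq_bigr => i _.
rewrite mxE mulr_sumr; apply: eq_bigr => j _.
by rewrite hessE mxE; ring.
Unshelve. all: by end_near. Qed.

(** The Hessian depends only on the germ at [a]: equality near [a] is equality near every point
    close to [a], hence equality of the partial derivatives near [a]. *)
Lemma near_eq_hessian_psd F G a : (\near a, F a = G a) ->
  has_hessian F a /\ positive_semidefinite (hessian F a) ->
  has_hessian G a /\ positive_semidefinite (hessian G a).
Proof.
move=> FG [[F1 F2] Fpsd].
have FG1 i : \near a, partial F i a = partial G i a.
  by apply: filterS (near_join FG) => x; exact: near_eq_derive.
have <- : hessian F a = hessian G a.
  apply/matrixP => i j; rewrite [LHS]mxE [RHS]mxE.
  exact: near_eq_derive (FG1 j).
split; last exact: Fpsd.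
split.
- near=> x => i; apply: (near_eq_derivable (f := F)).
    by near: x; exact: near_join FG.
  by move: i; near: x; exact: F1.
- by move=> i j; exact: near_eq_derivable (FG1 j) (F2 _ _).
Unshelve. all: by end_near. Qed.

End Hessian.

(** * Conformal factors *)

Definition vert0 : 'I_4 := @Ordinal 4 0 isT.
Definition vert1 : 'I_4 := @Ordinal 4 1 isT.
Definition vert2 : 'I_4 := @Ordinal 4 2 isT.
Definition vert3 : 'I_4 := @Ordinal 4 3 isT.

Lemma sum4E (V : nmodType) (F : 'I_4 -> V) :
  \sum_i F i = F vert0 + F vert1 + F vert2 + F vert3.
Proof.
rewrite !big_ord_recl big_ord0 addr0 !addrA.
by do ![congr (_ + _)]; congr F; apply/val_inj.
Qed.

Lemma sum_edgesE (V : nmodType) (F : 'I_4 -> 'I_4 -> V) :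
  \sum_(i < 4) \sum_(j < 4 | (i < j)%N) F i j =
  F vert0 vert1 + F vert0 vert2 + F vert0 vert3 +
  F vert1 vert2 + F vert1 vert3 + F vert2 vert3.
Proof.
under eq_bigr do rewrite big_mkcond sum4E.
by rewrite sum4E /= !(addr0, add0r) !addrA.
Qed.

Section ConformalFactors.
Context {R : realType}.
Implicit Types (x v w : 'rV[R]_4) (i j k l : 'I_4).

Definition inv_factor i x : R := expR (- x 0 i).

Definition edge_factor i j x : R := expR ((x 0 i + x 0 j) / 2).

Definition edge_dihedral i j k l x : R :=
  dihedral (inv_factor i x) (inv_factor j x) (inv_factor k x) (inv_factor l x).

Definition conformal_volume_poly x : R :=
  volume_poly (inv_factor vert0 x) (inv_factor vert1 x)
    (inv_factor vert2 x) (inv_factor vert3 x).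

(* A neighbourhood of the equal length metric, small enough for all the
   polynomials above to be positive on it. *)
Definition regular_region x : Prop :=
  forall i, 19 / 20 < inv_factor i x < 21 / 20.

Lemma is_derive_inv_factor i x v :
  is_derive x v (inv_factor i) (- (v 0 i * inv_factor i x)).
Proof.
have xi := is_derive_coord x v i.
have Nxi : is_derive x v (fun y : 'rV[R]_4 => - y 0 i) (- v 0 i).
  by apply: is_derive_eq.
refine (is_derive_eq (is_derive_comp Nxi (is_derive_expR _)) _).
by rewrite mulrN mulrC.
Qed.

Lemma is_derive_edge_factor i j x v :
  is_derive x v (edge_factor i j) ((v 0 i + v 0 j) / 2 * edge_factor i j x).
Proof.
have xi := is_derive_coord x v i.
have xj := is_derive_coord x v j.
have xij : is_derive x v (fun y : 'rV[R]_4 => (y 0 i + y 0 j) / 2)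
    ((v 0 i + v 0 j) / 2).
  by apply: is_derive_eq; rewrite /GRing.scale /=; ring.
refine (is_derive_eq (is_derive_comp xij (is_derive_expR _)) _).
by rewrite mulrC.
Qed.

Lemma inv_factor_gt0 i x : 0 < inv_factor i x.
Proof. exact: expR_gt0. Qed.

Lemma edge_factor_gt0 i j x : 0 < edge_factor i j x.
Proof. exact: expR_gt0. Qed.

Lemma edge_factor_sqr i j x :
  edge_factor i j x ^+ 2 = (inv_factor i x * inv_factor j x)^-1.
Proof.
rewrite -expRM_natl -expRD -expRN; congr expR.
by field.
Qed.

Lemma inv_factor0 i : inv_factor i 0 = 1.
Proof. by rewrite /inv_factor mxE oppr0 expR0. Qed.

Lemma edge_factor0 i j : edge_factor i j 0 = 1.
Proof. by rewrite /edge_factor !mxE addr0 mul0r expR0. Qed.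

Lemma regular_region0 : regular_region (0 : 'rV[R]_4).
Proof. by move=> i; rewrite inv_factor0; apply/andP; split; lra. Qed.

Lemma near_regular_region : \forall x \near (0 : 'rV[R]_4), regular_region x.
Proof.
pose near1 i (x : 'rV[R]_4) : Prop := 19 / 20 < inv_factor i x < 21 / 20.
have near1_all := @filter_forall _ _ near1 _ (nbhs_filter (0 : 'rV[R]_4)).
apply: near1_all => i.
have inv_cvg : {for (0 : 'rV[R]_4), continuous (inv_factor i)}.
  apply: continuous_comp; last exact: continuous_expR.
  apply: continuousN; exact: coord_continuous.
have /cvgr_lt lt := inv_cvg; have /cvgr_gt gt := inv_cvg.
rewrite inv_factor0 in lt gt.
near=> x; apply/andP; split; near: x; [apply: gt | apply: lt]; lra.
Unshelve. all: by end_near. Qed.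

Lemma face_poly_gt0 (a b c : R) : 19 / 20 < a < 21 / 20 ->
  19 / 20 < b < 21 / 20 -> 19 / 20 < c < 21 / 20 -> 0 < face_poly a b c.
Proof. by move=> /andP[? ?] /andP[? ?] /andP[? ?]; rewrite /face_poly; nra. Qed.

(** The polynomial is the sum of the four squares minus the six squared differences, and each
    difference is smaller than 1/10 in absolute value. *)
Lemma volume_poly_gt0 (a b c d : R) : 19 / 20 < a < 21 / 20 ->
  19 / 20 < b < 21 / 20 -> 19 / 20 < c < 21 / 20 -> 19 / 20 < d < 21 / 20 ->
  0 < volume_poly a b c d.
Proof.
move=> /andP[? ?] /andP[? ?] /andP[? ?] /andP[? ?]; rewrite /volume_poly.
have sqr_le (u t : R) : 19 / 20 < u < 21 / 20 -> 19 / 20 < t < 21 / 20 ->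
    (u - t) ^+ 2 < 1 / 100.
  by move=> /andP[? ?] /andP[? ?]; nra.
nra.
Qed.

End ConformalFactors.

(** * The functional EHR along a conformal class *)

Section Functionals.
Context {R : realType}.
Variable k : R.
Implicit Types (x v w : 'rV[R]_4) (i j m n : 'I_4).

Definition dinv_factor i x v : R := - (v 0 i * inv_factor i x).

Definition dedge_num i j m n x v : R :=
  ddihedral_num (inv_factor i x) (inv_factor j x) (inv_factor m x)
    (inv_factor n x) (dinv_factor i x v) (dinv_factor j x v)
    (dinv_factor m x v) (dinv_factor n x v).

Lemma is_derive_edge_dihedral i j m n x v :
  regular_region x ->
  is_derive x v (edge_dihedral i j m n)
    (- (dedge_num i j m n x v /
        Num.sqrt (2 * (inv_factor i x * inv_factor j x) *
          volume_poly (inv_factor i x) (inv_factor j x)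
            (inv_factor m x) (inv_factor n x)))).
Proof.
move=> xP.
apply: is_derive_dihedral; do ?exact: is_derive_inv_factor.
- exact: inv_factor_gt0.
- exact: inv_factor_gt0.
- exact: face_poly_gt0.
- exact: face_poly_gt0.
- exact: volume_poly_gt0.
Qed.

Definition edge_curvature i j m n x : R :=
  (2 * pi - 2 * edge_dihedral i j m n x) * (edge_factor i j x * k).

(** Only the part of the derivative that comes from the edge length, with the angle held fixed; the
    angle parts cancel in the sum over the edges. *)
Definition dedge_curvature i j m n v x : R :=
  (v 0 i + v 0 j) / 2 * edge_curvature i j m n x.

(** The angle part is written with a factor [2 * k / Num.sqrt (2 * conformal_volume_poly x)] common
    to all edges, as Schlafli's formula requires. *)
Lemma is_derive_edge_curvature i j m n x v :
  regular_region x ->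
  volume_poly (inv_factor i x) (inv_factor j x)
    (inv_factor m x) (inv_factor n x) = conformal_volume_poly x ->
  is_derive x v (edge_curvature i j m n)
    (dedge_curvature i j m n v x +
     2 * k / Num.sqrt (2 * conformal_volume_poly x) *
     (dedge_num i j m n x v / (inv_factor i x * inv_factor j x))).
Proof.
move=> xP xW.
have bx := is_derive_edge_dihedral i j m n v xP.
have sx := is_derive_edge_factor i j x v.
rewrite /edge_curvature.
apply: is_derive_eq; rewrite /GRing.scale /= /dedge_curvature /edge_curvature.
have W0 : 0 < conformal_volume_poly x by rewrite -xW volume_poly_gt0.
(* The product of the two inverse factors is [edge_factor i j x ^- 2], so it leaves the square root
   as the inverse of the edge factor. *)
have -> : Num.sqrt (2 * (inv_factor i x * inv_factor j x) *
    volume_poly (inv_factor i x) (inv_factor j x)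
      (inv_factor m x) (inv_factor n x)) =
    Num.sqrt (2 * conformal_volume_poly x) / edge_factor i j x.
  rewrite xW [_ * _ * conformal_volume_poly x]mulrAC.
  rewrite sqrtrM ?mulr_ge0 ?ler0n ?(ltW W0) //; congr (_ * _).
  rewrite -[inv_factor i x * _]invrK -edge_factor_sqr sqrtrV ?sqr_ge0 //.
  by rewrite sqrtr_sqr gtr0_norm ?edge_factor_gt0.
rewrite -[_ * inv_factor j x]invrK -edge_factor_sqr.
set s := edge_factor i j x; set r := Num.sqrt _.
have s0 : s != 0 by rewrite gt_eqF // edge_factor_gt0.
have r0 : r != 0.
  by rewrite gt_eqF // sqrtr_gt0 mulr_gt0 ?ltr0n.
by field; rewrite s0 r0.
Qed.

Definition conformal_EHR x : R :=
  edge_curvature vert0 vert1 vert2 vert3 x +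
  edge_curvature vert0 vert2 vert1 vert3 x +
  edge_curvature vert0 vert3 vert1 vert2 x +
  edge_curvature vert1 vert2 vert0 vert3 x +
  edge_curvature vert1 vert3 vert0 vert2 x +
  edge_curvature vert2 vert3 vert0 vert1 x.

Definition dconformal_EHR v x : R :=
  dedge_curvature vert0 vert1 vert2 vert3 v x +
  dedge_curvature vert0 vert2 vert1 vert3 v x +
  dedge_curvature vert0 vert3 vert1 vert2 v x +
  dedge_curvature vert1 vert2 vert0 vert3 v x +
  dedge_curvature vert1 vert3 vert0 vert2 v x +
  dedge_curvature vert2 vert3 vert0 vert1 v x.

Lemma is_derive_conformal_EHR x v :
  regular_region x -> is_derive x v conformal_EHR (dconformal_EHR v x).
Proof.
move=> xP.
have K01 := @is_derive_edge_curvature vert0 vert1 vert2 vert3 x v xP erefl.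
have K02 := @is_derive_edge_curvature vert0 vert2 vert1 vert3 x v xP.
have K03 := @is_derive_edge_curvature vert0 vert3 vert1 vert2 x v xP.
have K12 := @is_derive_edge_curvature vert1 vert2 vert0 vert3 x v xP.
have K13 := @is_derive_edge_curvature vert1 vert3 vert0 vert2 x v xP.
have K23 := @is_derive_edge_curvature vert2 vert3 vert0 vert1 x v xP.
(* [volume_poly] is symmetric, so the vertex order attached to each edge does not matter. *)
have {}K02 := K02 ltac:(rewrite /conformal_volume_poly /volume_poly; ring).
have {}K03 := K03 ltac:(rewrite /conformal_volume_poly /volume_poly; ring).
have {}K12 := K12 ltac:(rewrite /conformal_volume_poly /volume_poly; ring).
have {}K13 := K13 ltac:(rewrite /conformal_volume_poly /volume_poly; ring).
have {}K23 := K23 ltac:(rewrite /conformal_volume_poly /volume_poly; ring).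
rewrite /conformal_EHR; apply: is_derive_eq.
pose term i j m n := dedge_num i j m n x v / (inv_factor i x * inv_factor j x).
have sum0 : term vert0 vert1 vert2 vert3 + term vert0 vert2 vert1 vert3 +
    term vert0 vert3 vert1 vert2 + term vert1 vert2 vert0 vert3 +
    term vert1 vert3 vert0 vert2 + term vert2 vert3 vert0 vert1 = 0.
  by apply: schlafli; rewrite gt_eqF ?inv_factor_gt0 ?face_poly_gt0.
set c := 2 * k / _.
transitivity (dconformal_EHR v x + c * 0); last by rewrite mulr0 addr0.
rewrite -sum0 /term /dconformal_EHR; ring.
Qed.

(** The angle deficit 2 pi - 2 arccos(1/3) at every edge of the regular double tetrahedron. *)
Definition regular_deficit : R := 2 * pi - 2 * dihedral 1 1 1 1.

Lemma regular_deficit_ge0 : 0 <= regular_deficit.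
Proof.
rewrite /regular_deficit -mulrBr mulr_ge0 ?ler0n // subr_ge0.
rewrite acos_lepi //.
rewrite (_ : dihedral_poly 1 1 1 1 = 1); last by rewrite /dihedral_poly; ring.
rewrite (_ : face_poly 1 1 1 = 3); last by rewrite /face_poly; ring.
rewrite -expr2 sqrtr_sqr ger0_norm ?ler0n //.
by apply/andP; split; lra.
Qed.

(** The two terms are the variations of the deficit and of the length: at the regular tetrahedron
    the dihedral angle varies along [w] by -(2/3) / sqrt 8 times [w_i + w_j - w_m - w_n]. *)
Definition hess_edge_curvature i j m n v w : R :=
  k * (v 0 i + v 0 j) / 2 *
  (4 / 3 / Num.sqrt 8 * (w 0 i + w 0 j - w 0 m - w 0 n) +
   regular_deficit * (w 0 i + w 0 j) / 2).

Lemma is_derive_dedge_curvature i j m n v w :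
  is_derive 0 w (dedge_curvature i j m n v) (hess_edge_curvature i j m n v w).
Proof.
have zP := @regular_region0 R.
have bx := is_derive_edge_dihedral i j m n w zP.
have sx := is_derive_edge_factor i j 0 w.
rewrite /dedge_curvature /edge_curvature; apply: is_derive_eq.
rewrite /GRing.scale /= /hess_edge_curvature /regular_deficit /edge_dihedral.
rewrite /dedge_num /dinv_factor !inv_factor0 edge_factor0.
rewrite (_ : volume_poly 1 1 1 1 = 4); last by rewrite /volume_poly; ring.
rewrite (_ : 2 * (1 * 1) * 4 = 8); last by ring.
rewrite /ddihedral_num /ddihedral_poly /dface_poly.
rewrite (_ : dihedral_poly 1 1 1 1 = 1); last by rewrite /dihedral_poly; ring.
rewrite (_ : face_poly 1 1 1 = 3); last by rewrite /face_poly; ring.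
set r := Num.sqrt 8.
have r0 : r != 0 by rewrite gt_eqF // sqrtr_gt0 ltr0n.
by field; rewrite r0.
Qed.

Definition hess_conformal_EHR v w : R :=
  hess_edge_curvature vert0 vert1 vert2 vert3 v w +
  hess_edge_curvature vert0 vert2 vert1 vert3 v w +
  hess_edge_curvature vert0 vert3 vert1 vert2 v w +
  hess_edge_curvature vert1 vert2 vert0 vert3 v w +
  hess_edge_curvature vert1 vert3 vert0 vert2 v w +
  hess_edge_curvature vert2 vert3 vert0 vert1 v w.

Lemma is_derive_dconformal_EHR v w :
  is_derive 0 w (dconformal_EHR v) (hess_conformal_EHR v w).
Proof.
have K := is_derive_dedge_curvature.
have K01 := K vert0 vert1 vert2 vert3 v w.
have K02 := K vert0 vert2 vert1 vert3 v w.
have K03 := K vert0 vert3 vert1 vert2 v w.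
have K12 := K vert1 vert2 vert0 vert3 v w.
have K13 := K vert1 vert3 vert0 vert2 v w.
have K23 := K vert2 vert3 vert0 vert1 v w.
by rewrite /dconformal_EHR; apply: is_derive_eq.
Qed.

End Functionals.

(** * Hessians of the normalized functionals *)

Section QuotientHessian.
Context {R : realType} {n : nat}.
Variables (E G : 'rV[R]_n.+1 -> R) (a : 'rV[R]_n.+1).
Variables (dE dG hE hG : 'rV[R]_n.+1 -> 'rV[R]_n.+1 -> R).
Implicit Types v w : 'rV[R]_n.+1.

(* At a critical point of [E / G] the Hessian of the quotient is
   [(hess E - (E / G) hess G) / G]. *)
Lemma quotient_hessian_psd
    (H := fun v w => (hE v w - E a * hG v w / G a) / G a) :
  (\near a, forall v,
     [/\ G a != 0, is_derive a v E (dE v a) & is_derive a v G (dG v a)]) ->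
  (forall v w, is_derive a w (dE v) (hE v w)) ->
  (forall v w, is_derive a w (dG v) (hG v w)) ->
  (forall v, dE v a = E a * dG v a / G a) ->
  (forall v w, H v w = H w v) ->
  (forall v, H v v =
     \sum_i \sum_j v 0 i * v 0 j * H (delta_mx 0 j) (delta_mx 0 i)) ->
  (forall v, 0 <= H v v) ->
  has_hessian (fun x => E x / G x) a /\
  positive_semidefinite (hessian (fun x => E x / G x) a).
Proof.
move=> EGa dEa dGa crit.
apply: (@hessian_psd _ _ _ _ (fun v x => (dE v x - E x * dG v x / G x) / G x)).
  apply: filterS EGa => x Px v; have [G0 Ex Gx] := Px v.
  exact: is_derive_div.
move=> v w.
have [G0 Ex Gx] := nbhs_singleton EGa w.
have EdG : is_derive a w (fun x => E x * dG v x)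
    (dE w a * dG v a + E a * hG v w).
  have dGvw := dGa v w.
  by apply: is_derive_eq; rewrite /GRing.scale /=; ring.
have num1 := is_derive_div G0 EdG Gx.
have dEvw := dEa v w.
have num : is_derive a w (fun x => dE v x - E x * dG v x / G x)
   (hE v w -
    (dE w a * dG v a + E a * hG v w - E a * dG v a * dG w a / G a) / G a).
  by apply: is_derive_eq.
refine (is_derive_eq (is_derive_div G0 num Gx) _).
rewrite /H !crit; field.
exact: G0.
Qed.

End QuotientHessian.

(** * Normalization by total length *)

Section Normalizations.
Context {R : realType}.
Variable k : R.
Hypothesis k_gt0 : 0 < k.
Implicit Types (x v w : 'rV[R]_4) (i j m n : 'I_4).

Definition dedge_length i j v x : R :=
  (v 0 i + v 0 j) / 2 * (edge_factor i j x * k).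

Definition conformal_length x : R :=
  edge_factor vert0 vert1 x * k + edge_factor vert0 vert2 x * k +
  edge_factor vert0 vert3 x * k + edge_factor vert1 vert2 x * k +
  edge_factor vert1 vert3 x * k + edge_factor vert2 vert3 x * k.

Definition dconformal_length v x : R :=
  dedge_length vert0 vert1 v x + dedge_length vert0 vert2 v x +
  dedge_length vert0 vert3 v x + dedge_length vert1 vert2 v x +
  dedge_length vert1 vert3 v x + dedge_length vert2 vert3 v x.

Definition hess_edge_length i j v w : R :=
  k * (v 0 i + v 0 j) * (w 0 i + w 0 j) / 4.

Definition hess_conformal_length v w : R :=
  hess_edge_length vert0 vert1 v w + hess_edge_length vert0 vert2 v w +
  hess_edge_length vert0 vert3 v w + hess_edge_length vert1 vert2 v w +
  hess_edge_length vert1 vert3 v w + hess_edge_length vert2 vert3 v w.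

Lemma is_derive_conformal_length x v :
  is_derive x v conformal_length (dconformal_length v x).
Proof.
have s01 := is_derive_edge_factor vert0 vert1 x v.
have s02 := is_derive_edge_factor vert0 vert2 x v.
have s03 := is_derive_edge_factor vert0 vert3 x v.
have s12 := is_derive_edge_factor vert1 vert2 x v.
have s13 := is_derive_edge_factor vert1 vert3 x v.
have s23 := is_derive_edge_factor vert2 vert3 x v.
rewrite /conformal_length; apply: is_derive_eq.
rewrite /GRing.scale /= /dconformal_length /dedge_length; ring.
Qed.

Lemma is_derive_dconformal_length v w :
  is_derive 0 w (dconformal_length v) (hess_conformal_length v w).
Proof.
have s i j : is_derive 0 w (dedge_length i j v) (hess_edge_length i j v w).
  have sij := is_derive_edge_factor i j 0 w.
  rewrite /dedge_length; apply: is_derive_eq.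
  by rewrite /GRing.scale /= /hess_edge_length edge_factor0; field.
have s01 := s vert0 vert1.
have s02 := s vert0 vert2.
have s03 := s vert0 vert3.
have s12 := s vert1 vert2.
have s13 := s vert1 vert3.
have s23 := s vert2 vert3.
by rewrite /dconformal_length; apply: is_derive_eq.
Qed.

Lemma conformal_length_gt0 x : 0 < conformal_length x.
Proof. by rewrite /conformal_length !addr_gt0 // mulr_gt0 ?edge_factor_gt0. Qed.

Lemma edge_curvature0 i j m n :
  edge_curvature k i j m n 0 = regular_deficit * k.
Proof.
rewrite /edge_curvature /edge_dihedral !inv_factor0 edge_factor0 mul1r.
by rewrite /regular_deficit.
Qed.

Lemma conformal_EHR0 : conformal_EHR k 0 = 6 * (regular_deficit * k).
Proof. rewrite /conformal_EHR !edge_curvature0; ring. Qed.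

Lemma conformal_LEHR_psd :
  let F (x : 'rV[R]_4) := conformal_EHR k x / conformal_length x in
  has_hessian F 0 /\ positive_semidefinite (hessian F 0).
Proof.
have L0 : conformal_length 0 = 6 * k.
  by rewrite /conformal_length !edge_factor0; ring.
have k0 : k != 0 by rewrite gt_eqF.
have r0 : 0 < Num.sqrt (8 : R) by rewrite sqrtr_gt0 ltr0n.
apply: (@quotient_hessian_psd _ _ _ _ _ (dconformal_EHR k) dconformal_length
  (hess_conformal_EHR k) hess_conformal_length).
- apply: filterS (near_regular_region) => x xP v; split.
  + by rewrite gt_eqF // conformal_length_gt0.
  + exact: is_derive_conformal_EHR.
  + exact: is_derive_conformal_length.
- exact: is_derive_dconformal_EHR.
- exact: is_derive_dconformal_length.
- move=> v; rewrite conformal_EHR0 L0 /dconformal_EHR /dedge_curvature.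
  rewrite !edge_curvature0 /dconformal_length /dedge_length !edge_factor0.
  by field; rewrite k0.
- move=> v w; rewrite conformal_EHR0 L0 /hess_conformal_EHR.
  rewrite /hess_edge_curvature /hess_conformal_length /hess_edge_length.
  by field; rewrite k0 gt_eqF.
- move=> v; rewrite !sum4E conformal_EHR0 L0 /hess_conformal_EHR.
  rewrite /hess_edge_curvature /hess_conformal_length /hess_edge_length !mxE /=.
  by field; rewrite k0 gt_eqF.
- move=> v; rewrite conformal_EHR0 L0 /hess_conformal_EHR.
  rewrite /hess_edge_curvature /hess_conformal_length /hess_edge_length.
  (* At 0 the ratio of EHR to length is [regular_deficit], so the deficit part of the Hessian of EHR
     cancels against the Hessian of the length. In the angle part two opposite edges carry factors
     of opposite sign, and together they give a square. *)
  rewrite [X in 0 <= X](_ : _ = (9 * Num.sqrt 8)^-1 *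
    ((v 0 vert0 + v 0 vert1 - v 0 vert2 - v 0 vert3) ^+ 2 +
     (v 0 vert0 + v 0 vert2 - v 0 vert1 - v 0 vert3) ^+ 2 +
     (v 0 vert0 + v 0 vert3 - v 0 vert1 - v 0 vert2) ^+ 2)).
    rewrite mulr_ge0 ?invr_ge0 ?mulr_ge0 ?ler0n ?(ltW r0) //.
    by rewrite !addr_ge0 ?sqr_ge0.
  by field; rewrite k0 gt_eqF.
Qed.

End Normalizations.

(** * Normalization by the cube root of the volume *)

Section VolumeNormalization.
Context {R : realType}.
Variables (k c : R).
Hypotheses (k_gt0 : 0 < k) (c_gt0 : 0 < c).
Implicit Types (x v w : 'rV[R]_4).

Definition coord_sum v : R := v 0 vert0 + v 0 vert1 + v 0 vert2 + v 0 vert3.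

Definition dconformal_volume_poly v x : R :=
  dvolume_poly (inv_factor vert0 x) (inv_factor vert1 x)
    (inv_factor vert2 x) (inv_factor vert3 x)
    (dinv_factor vert0 x v) (dinv_factor vert1 x v)
    (dinv_factor vert2 x v) (dinv_factor vert3 x v).

(** The total volume of the double tetrahedron once [c] is sqrt((k^2/2)^3) / 3; the exponential is
    the inverse of the product of the four inverse factors. *)
Definition conformal_volume x : R :=
  c * Num.sqrt (conformal_volume_poly x) * expR (coord_sum x).

Definition conformal_scale x : R := conformal_volume x `^ 3^-1.

Definition dconformal_scale v x : R :=
  conformal_scale x *
  (3^-1 * (dconformal_volume_poly v x / conformal_volume_poly x / 2 +
           coord_sum v)).

(** At 0 the logarithmic derivative of the scale is a quarter of [coord_sum]. The coefficient 5/48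
    is 1/16, from the product of two such derivatives, plus 1/24, from the second logarithmic
    derivative, which also contributes the term with 1/6. *)
Definition hess_conformal_scale v w : R :=
  conformal_scale 0 *
  (5 / 48 * coord_sum v * coord_sum w -
   (v 0 vert0 * w 0 vert0 + v 0 vert1 * w 0 vert1 +
    v 0 vert2 * w 0 vert2 + v 0 vert3 * w 0 vert3) / 6).

Lemma conformal_volume_poly_gt0 x :
  regular_region x -> 0 < conformal_volume_poly x.
Proof. by move=> xP; apply: volume_poly_gt0. Qed.

Lemma conformal_volume_gt0 x : regular_region x -> 0 < conformal_volume x.
Proof.
by move=> xP; rewrite !mulr_gt0 ?expR_gt0 ?sqrtr_gt0 ?conformal_volume_poly_gt0.
Qed.

Lemma conformal_volume_poly0 : conformal_volume_poly 0 = 4 :> R.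
Proof. rewrite /conformal_volume_poly !inv_factor0 /volume_poly; ring. Qed.

Lemma dconformal_volume_poly0 v :
  dconformal_volume_poly v 0 = - 2 * coord_sum v.
Proof.
rewrite /dconformal_volume_poly /dvolume_poly /dinv_factor !inv_factor0.
rewrite /coord_sum; ring.
Qed.

Lemma is_derive_conformal_volume_poly x v :
  is_derive x v conformal_volume_poly (dconformal_volume_poly v x).
Proof. by apply: is_derive_volume_poly; exact: is_derive_inv_factor. Qed.

Lemma is_derive_conformal_scale x v : regular_region x ->
  is_derive x v conformal_scale (dconformal_scale v x).
Proof.
move=> xP.
have W0 := conformal_volume_poly_gt0 xP.
have V0 := conformal_volume_gt0 xP.
have Wx := is_derive_conformal_volume_poly x v.
have sWx := is_derive_comp Wx (is_derive1_sqrt W0).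
have x0 := is_derive_coord x v vert0.
have x1 := is_derive_coord x v vert1.
have x2 := is_derive_coord x v vert2.
have x3 := is_derive_coord x v vert3.
have Sx : is_derive x v coord_sum (coord_sum v) by apply: is_derive_eq.
have eSx := is_derive_comp Sx (is_derive_expR _).
have Vx : is_derive x v conformal_volume (conformal_volume x *
    (dconformal_volume_poly v x / conformal_volume_poly x / 2 + coord_sum v)).
  rewrite /conformal_volume; apply: is_derive_eq; rewrite /GRing.scale /=.
  have : 0 < Num.sqrt (conformal_volume_poly x) by rewrite sqrtr_gt0.
  have := sqr_sqrtr (ltW W0).
  move: (Num.sqrt _) => r <- r0.
  by field; rewrite gt_eqF.
refine (is_derive_eq (is_derive_comp Vx (is_derive1_powR _ V0)) _).
rewrite /dconformal_scale /conformal_scale.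
have -> : conformal_volume x `^ 3^-1 =
    conformal_volume x `^ (3^-1 - 1) * conformal_volume x.
  rewrite -{3}[conformal_volume x]powRr1 ?ltW // -powRD ?subrK //.
  by rewrite (gt_eqF V0) implybT.
ring.
Qed.

Lemma is_derive_dconformal_scale v w :
  is_derive 0 w (dconformal_scale v) (hess_conformal_scale v w).
Proof.
have zP := @regular_region0 R.
have W0_neq0 : conformal_volume_poly 0 != 0 :> R.
  by rewrite conformal_volume_poly0 pnatr_eq0.
have a0 := is_derive_inv_factor vert0 0 w.
have a1 := is_derive_inv_factor vert1 0 w.
have a2 := is_derive_inv_factor vert2 0 w.
have a3 := is_derive_inv_factor vert3 0 w.
have dWw : is_derive 0 w (dconformal_volume_poly v)
    (2 * coord_sum v * coord_sum w -
     4 * (v 0 vert0 * w 0 vert0 + v 0 vert1 * w 0 vert1 +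
          v 0 vert2 * w 0 vert2 + v 0 vert3 * w 0 vert3)).
  rewrite /dconformal_volume_poly /dvolume_poly /dinv_factor.
  apply: is_derive_eq; rewrite /GRing.scale /= !inv_factor0 /coord_sum; ring.
have Ww := is_derive_conformal_volume_poly 0 w.
have quow := is_derive_div W0_neq0 dWw Ww.
have Gw := is_derive_conformal_scale w zP.
rewrite /dconformal_scale; apply: is_derive_eq.
rewrite /GRing.scale /= /hess_conformal_scale /dconformal_scale.
rewrite !dconformal_volume_poly0 conformal_volume_poly0.
by field.
Qed.

Lemma conformal_VEHR_psd :
  let F (x : 'rV[R]_4) := conformal_EHR k x / conformal_scale x in
  has_hessian F 0 /\ positive_semidefinite (hessian F 0).
Proof.
have r0 : 0 < Num.sqrt (8 : R) by rewrite sqrtr_gt0 ltr0n.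
have G_gt0 x : regular_region x -> 0 < conformal_scale x.
  by move=> xP; rewrite powR_gt0 // conformal_volume_gt0.
have G0 := G_gt0 _ (@regular_region0 R).
apply: (@quotient_hessian_psd _ _ _ _ _ (dconformal_EHR k) dconformal_scale
  (hess_conformal_EHR k) hess_conformal_scale).
- apply: filterS near_regular_region => x xP v; split.
  + by rewrite gt_eqF // G_gt0.
  + exact: is_derive_conformal_EHR.
  + exact: is_derive_conformal_scale.
- exact: is_derive_dconformal_EHR.
- exact: is_derive_dconformal_scale.
- move=> v; rewrite conformal_EHR0 /dconformal_scale dconformal_volume_poly0.
  rewrite conformal_volume_poly0.
  rewrite /dconformal_EHR /dedge_curvature !edge_curvature0 /coord_sum.
  by field; rewrite gt_eqF.
- move=> v w; rewrite conformal_EHR0 /hess_conformal_EHR.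
  rewrite /hess_edge_curvature /hess_conformal_scale /coord_sum.
  by field; rewrite !gt_eqF.
- move=> v; rewrite !sum4E conformal_EHR0 /hess_conformal_EHR.
  rewrite /hess_edge_curvature /hess_conformal_scale /coord_sum !mxE /=.
  by field; rewrite !gt_eqF.
- move=> v; rewrite conformal_EHR0 /hess_conformal_EHR.
  rewrite /hess_edge_curvature /hess_conformal_scale /coord_sum.
  (* The angle part is the same sum of squares as for the length. With S the coordinate sum and q
     the sum of squared coordinates, the deficit part is (2q + S^2)/4 from EHR minus 6 (5 S^2/48 -
     q/6) from the scale, that is 3/8 of 4q - S^2, the sum of squared differences. *)
  rewrite [X in 0 <= X](_ : _ = (
    k * (2 / 3 / Num.sqrt 8 *
    ((v 0 vert0 + v 0 vert1 - v 0 vert2 - v 0 vert3) ^+ 2 +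
     (v 0 vert0 + v 0 vert2 - v 0 vert1 - v 0 vert3) ^+ 2 +
     (v 0 vert0 + v 0 vert3 - v 0 vert1 - v 0 vert2) ^+ 2)) +
    k * regular_deficit * (3 / 8) *
    ((v 0 vert0 - v 0 vert1) ^+ 2 + (v 0 vert0 - v 0 vert2) ^+ 2 +
     (v 0 vert0 - v 0 vert3) ^+ 2 + (v 0 vert1 - v 0 vert2) ^+ 2 +
     (v 0 vert1 - v 0 vert3) ^+ 2 + (v 0 vert2 - v 0 vert3) ^+ 2))
     / conformal_scale 0).
    have := @regular_deficit_ge0 R; have := ltW k_gt0.
    by move=> ? ?; rewrite divr_ge0 ?(ltW G0) // addr_ge0 // !mulr_ge0
      ?invr_ge0 ?ler0n ?(ltW r0) // !addr_ge0 ?sqr_ge0.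
  by field; rewrite !gt_eqF.
Qed.

End VolumeNormalization.

(** * Geometry of the tetrahedron *)

Section DotProduct.
Context {R : realType}.
Implicit Types (u v w e : 'rV[R]_3) (a b c d k : R).

Lemma dotC u v : dot u v = dot v u.
Proof. by rewrite /dot !mxE; apply: eq_bigr => i _; rewrite !mxE mulrC. Qed.

Lemma dotBl u v w : dot (u - v) w = dot u w - dot v w.
Proof. by rewrite /dot mulmxBl !mxE. Qed.

Lemma dotBr u v w : dot w (u - v) = dot w u - dot w v.
Proof. by rewrite dotC dotBl !(dotC w). Qed.

Lemma dotZl c u v : dot (c *: u) v = c * dot u v.
Proof. by rewrite /dot -scalemxAl mxE. Qed.

Lemma dotZr c u v : dot v (c *: u) = c * dot v u.
Proof. by rewrite dotC dotZl (dotC v). Qed.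

Lemma dot_ge0 u : 0 <= dot u u.
Proof.
rewrite /dot mxE; apply: sumr_ge0 => i _.
by rewrite mxE -expr2 sqr_ge0.
Qed.

Lemma dot_orthogonal_part e u v : dot e e != 0 ->
  dot (orthogonal_part e u) (orthogonal_part e v) =
  dot u v - dot u e * dot v e / dot e e.
Proof.
move=> e0; rewrite /orthogonal_part !(dotBl, dotBr, dotZl, dotZr).
rewrite (dotC e v); field.
exact: e0.
Qed.

Lemma dot_polarization u v :
  dot u v = (dot u u + dot v v - dot (v - u) (v - u)) / 2.
Proof. by rewrite !(dotBl, dotBr) (dotC v u); field. Qed.

(** Polarization expresses all inner products through squared edge lengths. The squared heights over
    [e] are then [p * face_poly a b c / c ^+ 2] and its analogue for [d], and the inner product of
    the heights is [p * dihedral_poly a b c d / (c * d)]; the extra factors cancel in the cosine. *)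
Lemma angle_orthogonal_part k a b c d e u v :
  0 < k -> 0 < a -> 0 < b -> 0 < c -> 0 < d -> 0 < face_poly a b c ->
  0 < face_poly a b d ->
  dot e e = k ^+ 2 / (a * b) -> dot u u = k ^+ 2 / (a * c) ->
  dot v v = k ^+ 2 / (a * d) -> dot (e - u) (e - u) = k ^+ 2 / (b * c) ->
  dot (e - v) (e - v) = k ^+ 2 / (b * d) ->
  dot (v - u) (v - u) = k ^+ 2 / (c * d) ->
  angle (orthogonal_part e u) (orthogonal_part e v) = dihedral a b c d.
Proof.
move=> k0 a0 b0 c0 d0 Q0 Q'0 ee uu vv eu ev uv.
have ee0 : dot e e != 0 by rewrite ee gt_eqF // divr_gt0 ?exprn_gt0 ?mulr_gt0.
have nz : [&& k != 0, a != 0, b != 0, c != 0 & d != 0] by rewrite !gt_eqF.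
have [kn an bn cn dn] := and5P nz.
pose p := k ^+ 2 / (4 * (a * b)).
have p0 : 0 < p by rewrite divr_gt0 ?exprn_gt0 ?mulr_gt0 ?ltr0n.
rewrite /angle /enorm !dot_orthogonal_part //.
rewrite (dot_polarization u v) (dot_polarization u e) (dot_polarization v e).
rewrite ee uu vv eu ev uv.
have -> : k ^+ 2 / (a * c) - (k ^+ 2 / (a * c) + k ^+ 2 / (a * b) -
    k ^+ 2 / (b * c)) / 2 * ((k ^+ 2 / (a * c) + k ^+ 2 / (a * b) -
    k ^+ 2 / (b * c)) / 2) / (k ^+ 2 / (a * b)) =
    p * face_poly a b c * (c^-1) ^+ 2.
  by rewrite /p /face_poly; field; rewrite kn an bn cn.
have -> : k ^+ 2 / (a * d) - (k ^+ 2 / (a * d) + k ^+ 2 / (a * b) -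
    k ^+ 2 / (b * d)) / 2 * ((k ^+ 2 / (a * d) + k ^+ 2 / (a * b) -
    k ^+ 2 / (b * d)) / 2) / (k ^+ 2 / (a * b)) =
    p * face_poly a b d * (d^-1) ^+ 2.
  by rewrite /p /face_poly; field; rewrite kn an bn dn.
rewrite /dihedral; congr acos.
have sqrtE q z : 0 < q -> 0 < z ->
    Num.sqrt (p * q * z^-1 ^+ 2) = Num.sqrt p * Num.sqrt q / z.
  move=> q0 z0; have pq0 : 0 <= p * q by apply/ltW/mulr_gt0.
  rewrite (sqrtrM _ pq0).
  by rewrite (sqrtrM _ (ltW p0)) sqrtr_sqr gtr0_norm ?invr_gt0.
rewrite !sqrtE // [in RHS]sqrtrM ?ltW //.
have sp0 : Num.sqrt p != 0 by rewrite gt_eqF ?sqrtr_gt0.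
have sQ0 : Num.sqrt (face_poly a b c) != 0 by rewrite gt_eqF ?sqrtr_gt0.
have sQ'0 : Num.sqrt (face_poly a b d) != 0 by rewrite gt_eqF ?sqrtr_gt0.
set q := Num.sqrt (face_poly a b c) in sQ0 *.
set q' := Num.sqrt (face_poly a b d) in sQ'0 *.
transitivity (p * dihedral_poly a b c d / (c * d) /
  (Num.sqrt p ^+ 2 * q * q' / (c * d))).
  congr (_ / _); last by field; rewrite cn dn.
  by rewrite /p /dihedral_poly; field; rewrite kn an bn cn dn.
rewrite sqr_sqrtr ?ltW //; field.
by rewrite sQ0 sQ'0 cn dn gt_eqF.
Qed.

End DotProduct.

(** * Gram determinants and Cholesky factors in dimension three *)

Section Coordinates.
Context {R : realType}.
Implicit Types (u v : 'rV[R]_3).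

Definition coord0 : 'I_3 := @Ordinal 3 0 isT.
Definition coord1 : 'I_3 := @Ordinal 3 1 isT.
Definition coord2 : 'I_3 := @Ordinal 3 2 isT.

Lemma sum3E (V : nmodType) (F : 'I_3 -> V) :
  \sum_i F i = F coord0 + F coord1 + F coord2.
Proof.
rewrite !big_ord_recl big_ord0 addr0 !addrA.
by do ![congr (_ + _)]; congr F; apply/val_inj.
Qed.

Lemma dot3E u v :
  dot u v = u 0 coord0 * v 0 coord0 + u 0 coord1 * v 0 coord1 +
            u 0 coord2 * v 0 coord2.
Proof. by rewrite /dot mxE sum3E !mxE. Qed.

Lemma det3E (A : 'M[R]_3) :
  \det A =
  A coord0 coord0 * (A coord1 coord1 * A coord2 coord2 -
                     A coord1 coord2 * A coord2 coord1) -
  A coord0 coord1 * (A coord1 coord0 * A coord2 coord2 -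
                     A coord1 coord2 * A coord2 coord0) +
  A coord0 coord2 * (A coord1 coord0 * A coord2 coord1 -
                     A coord1 coord1 * A coord2 coord0).
Proof.
(* Indexing by natural numbers lets the nested lifts of the cofactor expansion compute to
   numerals. *)
pose f (m n : nat) := A (inord m) (inord n).
have AE i j : A i j = f i j by rewrite /f !inord_val.
rewrite (expand_det_row _ ord0) !big_ord_recl big_ord0 /cofactor.
rewrite !(expand_det_row _ ord0) !big_ord_recl !big_ord0 /cofactor !det_mx11.
rewrite !mxE !AE /= /bump /=; ring.
Qed.

(** The right-hand side is the Gram determinant of the three edges at the first vertex, det(M M^T) =
    det(M)^2. *)
Lemma sqr_det_edge_matrix (P : 'M[R]_(4, 3)) :
  let u i := row i P - row ord0 P in
  let g i j := dot (u i) (u j) in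
  \det (edge_matrix P) ^+ 2 =
  g vert1 vert1 * (g vert2 vert2 * g vert3 vert3 - g vert2 vert3 ^+ 2) -
  g vert1 vert2 * (g vert1 vert2 * g vert3 vert3 - g vert2 vert3 * g vert1 vert3) +
  g vert1 vert3 * (g vert1 vert2 * g vert2 vert3 - g vert2 vert2 * g vert1 vert3).
Proof.
move=> u g.
have uE i j : edge_matrix P i j = u (lift ord0 i) 0 j by rewrite mxE.
rewrite det3E !uE.
have -> : lift ord0 coord0 = vert1 by apply/val_inj.
have -> : lift ord0 coord1 = vert2 by apply/val_inj.
have -> : lift ord0 coord2 = vert3 by apply/val_inj.
rewrite /g !dot3E; ring.
Qed.

(** The hypotheses are Sylvester's criterion. The rows (p), (q, r), (s, t, u) form a lower
    triangular factor whose squared diagonal entries are the ratios of successive leading minors. *)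
Lemma gram3_cholesky (g11 g12 g13 g22 g23 g33 : R) :
  0 < g11 -> 0 < g11 * g22 - g12 ^+ 2 ->
  0 < g11 * (g22 * g33 - g23 ^+ 2) - g12 * (g12 * g33 - g23 * g13) +
      g13 * (g12 * g23 - g22 * g13) ->
  exists p q r s t u : R,
    [/\ [/\ 0 < p, 0 < r & 0 < u],
        [/\ p ^+ 2 = g11, p * q = g12 & p * s = g13],
        [/\ q ^+ 2 + r ^+ 2 = g22 & q * s + r * t = g23] &
        s ^+ 2 + t ^+ 2 + u ^+ 2 = g33].
Proof.
set m := g11 * g22 - _; set D := _ + _ => g11_gt0 m_gt0 D_gt0.
pose p := Num.sqrt g11.
have p0 : 0 < p by rewrite sqrtr_gt0.
have p2 : p ^+ 2 = g11 by rewrite sqr_sqrtr ?ltW.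
pose r := Num.sqrt (m / g11).
have r0 : 0 < r by rewrite sqrtr_gt0 divr_gt0.
have r2 : r ^+ 2 = m / g11 by rewrite sqr_sqrtr // ltW ?divr_gt0.
pose w := Num.sqrt (D / m).
have w0 : 0 < w by rewrite sqrtr_gt0 divr_gt0.
have w2 : w ^+ 2 = D / m by rewrite sqr_sqrtr // ltW ?divr_gt0.
have p_neq0 : p != 0 by rewrite gt_eqF.
have r_neq0 : r != 0 by rewrite gt_eqF.
have g11_neq0 : g11 != 0 by rewrite gt_eqF.
have m_neq0 : m != 0 by rewrite gt_eqF.
exists p, (g12 / p), r, (g13 / p), ((g23 - g12 * g13 / g11) / r), w.
split=> //.
- by split=> //; rewrite mulrC divfK.
- split; first by rewrite expr_div_n p2 r2 /m; field.
  by rewrite mulf_div -expr2 p2 [r * _]mulrC divfK //; ring.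
- rewrite !expr_div_n p2 r2 w2 /D /m; field.
  by rewrite g11_neq0 m_neq0.
Qed.

End Coordinates.

(** * Tetrahedra realizing the metrics of the conformal class *)

Section ConformalTetrahedron.
Context {R : realType}.
Variables (k : R) (L : 'I_4 -> 'I_4 -> R).
Hypotheses (k_gt0 : 0 < k)
  (L_eq : forall i j : 'I_4, (i < j)%N -> L i j = k).
Implicit Types (x : 'rV[R]_4) (i j m n : 'I_4) (P : 'M[R]_(4, 3)).

Lemma edge_ind (T : 'I_4 -> 'I_4 -> Prop) :
  T vert0 vert1 -> T vert0 vert2 -> T vert0 vert3 ->
  T vert1 vert2 -> T vert1 vert3 -> T vert2 vert3 ->
  forall i j : 'I_4, (i < j)%N -> T i j.
Proof.
move=> T01 T02 T03 T12 T13 T23.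
have e0 h : @Ordinal 4 0 h = vert0 by apply/val_inj.
have e1 h : @Ordinal 4 1 h = vert1 by apply/val_inj.
have e2 h : @Ordinal 4 2 h = vert2 by apply/val_inj.
have e3 h : @Ordinal 4 3 h = vert3 by apply/val_inj.
by case=> [[|[|[|[|//]]]] hi] [[|[|[|[|//]]]] hj] //= _;
  rewrite ?(e0, e1, e2, e3).
Qed.

Lemma conformalE x i j : (i < j)%N -> conformal L x i j = edge_factor i j x * k.
Proof. by move=> ij; rewrite /conformal L_eq. Qed.

Lemma conformal_dist P x i j : generates P (conformal L x) -> i != j ->
  dot (row j P - row i P) (row j P - row i P) =
  k ^+ 2 / (inv_factor i x * inv_factor j x).
Proof.
move=> [_ Px].
have lt_dist (a b : 'I_4) : (a < b)%N ->
    dot (row b P - row a P) (row b P - row a P) =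
    k ^+ 2 / (inv_factor a x * inv_factor b x).
  move=> ab; rewrite -[LHS]sqr_sqrtr ?dot_ge0 // -/(enorm _) Px //.
  by rewrite conformalE // exprMn edge_factor_sqr mulrC.
rewrite neq_ltn => /orP[/lt_dist //|/lt_dist ji].
rewrite [inv_factor i x * _]mulrC -ji -(opprB (row i P)).
by rewrite -scaleN1r dotZl dotZr !mulN1r opprK.
Qed.

Lemma conformal_angle P x i j m n : regular_region x ->
  generates P (conformal L x) -> uniq [:: i; j; m; n] ->
  angle (orthogonal_part (row j P - row i P) (row m P - row i P))
        (orthogonal_part (row j P - row i P) (row n P - row i P)) =
  edge_dihedral i j m n x.
Proof.
move=> xP Px; rewrite /= !inE !negb_or.
move=> /and4P[/and3P[ij im iN] /andP[jm jn] mn _].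
have cancel (u v w : 'rV[R]_3) : u - w - (v - w) = u - v.
  by rewrite opprB addrA subrK.
apply: (angle_orthogonal_part k_gt0);
  do ?[exact: inv_factor_gt0 | exact: face_poly_gt0].
- exact: conformal_dist.
- exact: conformal_dist.
- exact: conformal_dist.
- by rewrite cancel (conformal_dist Px) 1?eq_sym // [inv_factor m x * _]mulrC.
- by rewrite cancel (conformal_dist Px) 1?eq_sym // [inv_factor n x * _]mulrC.
- by rewrite cancel (conformal_dist Px) // eq_sym.
Qed.

Lemma enum4E : enum 'I_4 = [:: vert0; vert1; vert2; vert3].
Proof. by apply: (inj_map val_inj); rewrite val_enum_ord. Qed.

(** The Gram determinant is determined by the edge lengths through polarization, so the value is the
    same for every generating tetrahedron. *)
Lemma conformal_volume_tetrahedron P x : regular_region x ->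
  generates P (conformal L x) ->
  2 * volume P = conformal_volume (Num.sqrt ((k ^+ 2 / 2) ^+ 3) / 3) x.
Proof.
move=> xP Px.
have W0 := conformal_volume_poly_gt0 xP.
pose a i := inv_factor i x.
have an i : a i != 0 by rewrite gt_eqF // inv_factor_gt0.
have det2 : \det (edge_matrix P) ^+ 2 =
    (k ^+ 2 / 2) ^+ 3 * conformal_volume_poly x * expR (coord_sum x) ^+ 2.
  have -> : expR (coord_sum x) = (a vert0 * a vert1 * a vert2 * a vert3)^-1.
    rewrite -!expRD -expRN; congr expR; rewrite /coord_sum; ring.
  have diag i : vert0 != i ->
      dot (row i P - row ord0 P) (row i P - row ord0 P) =
      k ^+ 2 / (a vert0 * a i).
    move=> i0; rewrite -(conformal_dist Px i0) (_ : ord0 = vert0) //.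
    exact/val_inj.
  have offdiag i j : vert0 != i -> vert0 != j -> i != j ->
      dot (row i P - row ord0 P) (row j P - row ord0 P) =
      (k ^+ 2 / (a vert0 * a i) + k ^+ 2 / (a vert0 * a j) -
       k ^+ 2 / (a i * a j)) / 2.
    move=> i0 j0 ij; rewrite dot_polarization !diag //.
    by rewrite opprB addrA subrK (conformal_dist Px ij).
  rewrite sqr_det_edge_matrix /= !diag // !offdiag //.
  rewrite /conformal_volume_poly -!/(a _) /volume_poly; field.
  by rewrite !an.
have -> : 2 * volume P = Num.sqrt (\det (edge_matrix P) ^+ 2) / 3.
  by rewrite sqrtr_sqr /volume; field.
have k3 : 0 <= (k ^+ 2 / 2) ^+ 3 by rewrite exprn_ge0 ?divr_ge0 ?sqr_ge0 ?ler0n.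
rewrite det2 (sqrtrM _ (mulr_ge0 k3 (ltW W0))) (sqrtrM _ k3).
rewrite sqrtr_sqr gtr0_norm ?expR_gt0 // /conformal_volume; ring.
Qed.

(** The would-be Gram matrix of the edges at the first vertex has leading minors that are positive
    multiples of 1, [face_poly] and [volume_poly], so its Cholesky rows serve as the other three
    vertices. This keeps [tetrahedron] away from its default value. *)
Lemma generates_conformal x : regular_region x ->
  exists P, generates P (conformal L x).
Proof.
move=> xP.
pose a i := inv_factor i x.
have a0 i : 0 < a i by exact: inv_factor_gt0.
have an i : a i != 0 by rewrite gt_eqF.
have kn : k != 0 by rewrite gt_eqF.
pose d i j := k ^+ 2 / (a i * a j).
pose g i j := (d vert0 i + d vert0 j - d i j) / 2.
have d0 i j : 0 < d i j by rewrite divr_gt0 ?exprn_gt0 ?mulr_gt0.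
have face0 := face_poly_gt0 (xP vert0) (xP vert1) (xP vert2).
have W0 := conformal_volume_poly_gt0 xP.
have g2 : d vert0 vert1 * d vert0 vert2 - g vert1 vert2 ^+ 2 =
    k ^+ 4 / 4 * face_poly (a vert0) (a vert1) (a vert2) /
    (a vert0 * a vert1 * a vert2) ^+ 2.
  by rewrite /g /d /face_poly; field; rewrite !an.
have g3 : d vert0 vert1 * (d vert0 vert2 * d vert0 vert3 - g vert2 vert3 ^+ 2) -
    g vert1 vert2 * (g vert1 vert2 * d vert0 vert3 - g vert2 vert3 * g vert1 vert3) +
    g vert1 vert3 * (g vert1 vert2 * g vert2 vert3 - d vert0 vert2 * g vert1 vert3) =
    (k ^+ 2 / 2) ^+ 3 * conformal_volume_poly x /
    (a vert0 * a vert1 * a vert2 * a vert3) ^+ 2.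
  rewrite /conformal_volume_poly -!/(a _) /g /d /volume_poly; field.
  by rewrite !an.
have := @gram3_cholesky R (d vert0 vert1) (g vert1 vert2) (g vert1 vert3)
  (d vert0 vert2) (g vert2 vert3) (d vert0 vert3) (d0 _ _).
rewrite g2 g3.
case=> [||p [q [r [s [t [u [[p0 r0 u0] [p2 pq ps] [qr qs] stu]]]]]]].
- by rewrite !(divr_gt0, mulr_gt0, exprn_gt0, ltr0n).
- by rewrite !(divr_gt0, mulr_gt0, exprn_gt0, ltr0n).
pose P : 'M[R]_(4, 3) := \matrix_(i, j)
  nth 0 (nth [::] [:: [:: 0; 0; 0]; [:: p; 0; 0]; [:: q; r; 0]; [:: s; t; u]] i) j.
exists P; split.
  rewrite /Defs.nondegenerate det3E !mxE /= !(subr0, mulr0, mul0r, addr0).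
  by rewrite gt_eqF // !mulr_gt0.
move=> i j ij; rewrite conformalE //.
have l0 : 0 <= edge_factor i j x * k.
  by apply: mulr_ge0; apply: ltW; rewrite ?edge_factor_gt0.
rewrite -[RHS]ger0_norm // -sqrtr_sqr /enorm; congr Num.sqrt.
rewrite exprMn edge_factor_sqr mulrC -/(a i) -/(a j) -/(d i j).
move: i j ij {l0}; apply: edge_ind; rewrite dot3E !mxE /=.
- by rewrite -p2; ring.
- by rewrite -qr; ring.
- by rewrite -stu; ring.
- transitivity (p ^+ 2 + (q ^+ 2 + r ^+ 2) - 2 * (p * q)); first by ring.
  by rewrite p2 qr pq /g; field.
- transitivity (p ^+ 2 + (s ^+ 2 + t ^+ 2 + u ^+ 2) - 2 * (p * s)); first by ring.
  by rewrite p2 stu ps /g; field.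
- transitivity (q ^+ 2 + r ^+ 2 + (s ^+ 2 + t ^+ 2 + u ^+ 2) -
    2 * (q * s + r * t)); first by ring.
  by rewrite qr stu qs /g; field.
Qed.

Lemma generates_tetrahedron x : regular_region x ->
  generates (tetrahedron (conformal L x)) (conformal L x).
Proof.
by move=> xP; apply: (@xgetPex _ _ [set P | generates P _]%classic);
  exact: generates_conformal.
Qed.

Lemma curvature_conformal x i j m n : regular_region x -> (i < j)%N ->
  other_vertices i j = [:: m; n] -> uniq [:: i; j; m; n] ->
  curvature (conformal L x) i j = edge_curvature k i j m n x.
Proof.
move=> xP ij mn ijmn; rewrite /curvature /edge_curvature conformalE //.
rewrite /dihedral_angle mn /= (conformal_angle xP) //.
exact: generates_tetrahedron.
Qed.

Lemma EHR_conformal x : regular_region x ->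
  EHR (conformal L x) = conformal_EHR k x.
Proof.
move=> xP; rewrite /EHR sum_edgesE /conformal_EHR.
by do ![congr (_ + _)]; apply: curvature_conformal => //;
  rewrite /other_vertices enum4E.
Qed.

Lemma LEHR_conformal x : regular_region x ->
  LEHR (conformal L x) = conformal_EHR k x / conformal_length k x.
Proof.
move=> xP; rewrite /LEHR EHR_conformal //.
by rewrite /total_length sum_edgesE !conformalE.
Qed.

Lemma VEHR_conformal x : regular_region x ->
  VEHR (conformal L x) =
  conformal_EHR k x / conformal_scale (Num.sqrt ((k ^+ 2 / 2) ^+ 3) / 3) x.
Proof.
move=> xP; rewrite /VEHR EHR_conformal // /conformal_scale /total_volume.
by rewrite (conformal_volume_tetrahedron xP (generates_tetrahedron xP)).
Qed.

End ConformalTetrahedron.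

Theorem theorem4p4 (R : realType) (k : R) (L : 'I_4 -> 'I_4 -> R)
    (k_gt0 : 0 < k)
    (L_eq : forall i j : 'I_4, (i < j)%N -> L i j = k) :
  (has_hessian (fun f : 'rV[R]_4 => LEHR (conformal L f)) 0 /\
   positive_semidefinite
     (hessian (fun f : 'rV[R]_4 => LEHR (conformal L f)) 0)) /\
  (has_hessian (fun f : 'rV[R]_4 => VEHR (conformal L f)) 0 /\
   positive_semidefinite
     (hessian (fun f : 'rV[R]_4 => VEHR (conformal L f)) 0)).
Proof.
split.
(* The explicit formulas are available on [regular_region], a neighbourhood of 0, which is enough to
   determine the Hessian. *)
- apply: near_eq_hessian_psd (conformal_LEHR_psd k_gt0).
  apply: filterS near_regular_region => x xP.
  by rewrite (LEHR_conformal k_gt0 L_eq).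
- have c_gt0 : 0 < Num.sqrt ((k ^+ 2 / 2) ^+ 3) / 3.
    by rewrite divr_gt0 ?sqrtr_gt0 ?exprn_gt0 ?divr_gt0 ?exprn_gt0 ?ltr0n.
  apply: near_eq_hessian_psd (conformal_VEHR_psd k_gt0 c_gt0).
  apply: filterS near_regular_region => x xP.
  by rewrite (VEHR_conformal k_gt0 L_eq).
Qed.
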